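(* Let $(X,\Omega)$ be a measurable space, let $A$ be a $\sigma$-monotone complete partially ordered algebra with a $\sigma$-monotone continuous multiplication, and let $\mu\colon\Omega\to\overline{A^+}$ be a measure. Then the following are equivalent: (1) $\mathcal L^1(X,\Omega,\mu;\mathbb R)$ is a commutative algebra, and $I_\mu\colon\mathcal L^1(X,\Omega,\mu;\mathbb R)\to A$ is an algebra homomorphism; (2) $\mu$ is a spectral measure. When $\mu$ is finite, these are also equivalent to each of: (3) $I_\mu\colon\mathcal B(X,\Omega;\mathbb R)\to A$ is an algebra homomorphism; (4) $\mu(\Delta)^2=\mu(\Delta)$ for $\Delta\in\Omega$ and $\mu(\Delta_1)\mu(\Delta_2)=\mu(\Delta_2)\mu(\Delta_1)$ for $\Delta_1,\Delta_2\in\Omega$.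
   Context: All vector spaces are over $\mathbb R$; $\mathbb R^+=[0,\infty)$. A partially ordered vector space has a proper (not necessarily generating) positive cone and is always supposed to be Archimedean. $x_n\uparrow x$ means that $(x_n)$ is an increasing sequence with supremum $x$. It is $\sigma$-monotone complete if every increasing sequence that is bounded above has a supremum. A partially ordered algebra $A$ is an associative algebra that is also a partially ordered vector space, with positive cone $A^+$, such that $ab\in A^+$ for $a,b\in A^+$; no identity element is assumed. Its multiplication is $\sigma$-monotone continuous if, for all sequences in $A^+$ with $a_n\uparrow a\in A^+$, one has $ba_n\uparrow ba$ and $a_nb\uparrow ab$ for all $b\in A^+$. Algebra homomorphisms need not be unital. $\overline A=A\cup\{\infty\}$ with $\infty$ as largest element, and $\overline{A^+}=A^+\cup\{\infty\}$ with the obvious addition and action of $\mathbb R^+$. A measure $\mu\colon\Omega\to\overline{A^+}$ is a map with $\mu(\emptyset)=0$ and $\mu(\bigcup_n\Delta_n)=\bigvee_{N}\sum_{n=1}^N\mu(\Delta_n)$ in $\overline A$ for every pairwise disjoint sequence in the $\sigma$-algebra $\Omega$. It is finite if $\mu(X)\in A$; $\Delta$ has finite measure if $\mu(\Delta)\in A$. $\mu$ is a spectral measure if $\mu(\Delta_1\cap\Delta_2)=\mu(\Delta_1)\mu(\Delta_2)$ for all $\Delta_1,\Delta_2\in\Omega$ with finite measure. Order integral: for $\varphi=\sum_{i=1}^n r_i\chi_{\Delta_i}$ with $r_i\in\mathbb R^+$ and disjoint $\Delta_i\in\Omega$, $\int_X^{o}\varphi\,d\mu=\sum r_i\mu(\Delta_i)\in\overline{A^+}$;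 for measurable $f\colon X\to[0,\infty]$, $\int_X^{o}f\,d\mu=\bigvee_n\int_X^{o}\varphi_n\,d\mu$ for any sequence of such $\varphi_n\uparrow f$ pointwise (independent of the choice). $\mathcal L^1(X,\Omega,\mu;\mathbb R)$ consists of the measurable $f\colon X\to\mathbb R$ with $\int_X^{o}|f|\,d\mu\in A$, and then $I_\mu(f)=\int^{o}_X f\,d\mu=\int^{o}_Xf^+\,d\mu-\int^{o}_Xf^-\,d\mu$. $\mathcal B(X,\Omega;\mathbb R)$ is the algebra of bounded measurable functions. Multiplication of functions is pointwise. *)

(* Defs.v *)
From HB Require Import structures.
From mathcomp Require Import all_boot all_order all_algebra.
From mathcomp Require Import all_classical all_reals all_analysis.
Set Implicit Arguments.
Unset Strict Implicit.
Unset Printing Implicit Defensive.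
Import Order.TTheory GRing.Theory Num.Theory.
Import numFieldNormedType.Exports.
Local Open Scope classical_set_scope.
Local Open Scope ring_scope.

(* The cone is [set x | 0 <= x]; it is proper because <= is antisymmetric. *)
HB.mixin Record isPOVectorSpace (R : realType) E
    of GRing.Lmodule R E & Num.POrderedZmodule E := {
  pov_leD2r : forall z x y : E, x <= y -> x + z <= y + z ;
  pov_scale_ge0 : forall (r : R) (x : E), 0 <= r -> 0 <= x -> 0 <= r *: x ;
  pov_archimedean : forall x y : E, (forall n : nat, y *+ n <= x) -> y <= 0
}.

#[short(type="poVectType")]
HB.structure Definition POVectorSpace (R : realType) :=
  {E of isPOVectorSpace R E & GRing.Lmodule R E & Num.POrderedZmodule E}.

(* MathComp's algebras are unital, so the product is the semigroup law
   (x * y)%g, made bilinear here. *)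
HB.mixin Record isPOAlgebra (R : realType) A
    of POVectorSpace R A & Semigroup A := {
  poalg_mulDl : forall a b c : A, ((a + b)%R * c)%g = (a * c)%g + (b * c)%g ;
  poalg_mulDr : forall a b c : A, (a * (b + c)%R)%g = (a * b)%g + (a * c)%g ;
  poalg_scaleAl : forall (r : R) (a b : A), ((r *: a) * b)%g = r *: (a * b)%g ;
  poalg_scaleAr : forall (r : R) (a b : A), (a * (r *: b))%g = r *: (a * b)%g ;
  poalg_mul_ge0 : forall a b : A, 0 <= a -> 0 <= b -> 0 <= (a * b)%g
}.

#[short(type="poAlgType")]
HB.structure Definition POAlgebra (R : realType) :=
  {A of isPOAlgebra R A & POVectorSpace R A & Semigroup A}.

Definition increases_to d (T : porderType d) (u : nat -> T) (x : T) : Prop :=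
  nondecreasing_seq u /\ supremums (range u) x.

Definition sigma_monotone_complete d (T : porderType d) : Prop :=
  forall u : nat -> T, nondecreasing_seq u -> has_ubound (range u) ->
  exists x, supremums (range u) x.

Definition sigma_monotone_continuous_mul (R : realType) (A : poAlgType R) :
    Prop :=
  forall (u : nat -> A) (a : A),
  (forall n, 0 <= u n) -> 0 <= a -> increases_to u a ->
  forall b : A, 0 <= b ->
    increases_to (fun n => (b * u n)%g) (b * a)%g /\
    increases_to (fun n => (u n * b)%g) (a * b)%g.

(* [topped E] is E with a largest element [infty] adjoined. *)
Definition topped (E : Type) : Type := option E.
Definition fin (E : Type) (x : E) : topped E := Some x.
Definition infty (E : Type) : topped E := None.
Arguments infty {E}.

HB.instance Definition _ (E : choiceType) := Choice.copy (topped E) (option E).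

Section topped_order.
Context (E : porderZmodType).
Implicit Types x y z : topped E.

Definition topped_le x y : bool :=
  match x, y with
  | _, None => true
  | None, Some _ => false
  | Some a, Some b => a <= b
  end.

Lemma topped_le_refl : reflexive topped_le.
Proof. by case=> [a|] //=. Qed.

Lemma topped_le_anti : antisymmetric topped_le.
Proof. by case=> [a|] [b|] //= /le_anti ->. Qed.

Lemma topped_le_trans : transitive topped_le.
Proof. by case=> [b|] [a|] [c|] //=; exact: le_trans. Qed.

Definition topped_add x y : topped E :=
  match x, y with
  | Some a, Some b => fin (a + b)
  | _, _ => infty
  end.

Lemma topped_addA : associative topped_add.
Proof. by case=> [a|] [b|] [c|] //=; rewrite addrA. Qed.

Lemma topped_addC : commutative topped_add.
Proof. by case=> [a|] [b|] //=; rewrite addrC. Qed.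

Lemma topped_add0 : left_id (fin 0) topped_add.
Proof. by case=> [a|] //=; rewrite add0r. Qed.

End topped_order.

HB.instance Definition _ (E : porderZmodType) :=
  Order.Le_isPOrder.Build ring_display (topped E)
    (@topped_le_refl E) (@topped_le_anti E) (@topped_le_trans E).

HB.instance Definition _ (E : porderZmodType) :=
  GRing.isNmodule.Build (topped E)
    (@topped_addA E) (@topped_addC E) (@topped_add0 E).

(* Used only for 0 <= r; note 0 * infty = 0. *)
Definition topped_scale (R : realType) (E : lmodType R) (r : R)
    (x : topped E) : topped E :=
  match x with
  | Some a => fin (r *: a)
  | None => if r == 0 then fin 0 else infty
  end.

(* The value in E of a finite element, and 0 at infinity. *)
Definition fin_part (E : zmodType) (x : topped E) : E := odflt 0 x.

Section measurability.
Context (X : Type) (Omega : set (set X)).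

(* Any set X and any sigma-algebra Omega are allowed, including X empty; the
   library's [measurable_fun] requires a pointed X. *)
Definition measurable_map d (Y : measurableType d) (f : X -> Y) : Prop :=
  forall B : set Y, measurable B -> Omega (f @^-1` B).

Definition nonneg_simple (R : realType) (phi : X -> R) : Prop :=
  [/\ measurable_map phi, finite_set (range phi) & forall x, 0 <= phi x].

Definition bounded_measurable (R : realType) : set (X -> R) :=
  [set f : X -> R | measurable_map f /\ exists M : R, forall x, `|f x| <= M].

End measurability.

Section order_integral.
Context (X : Type) (Omega : set (set X)) (R : realType) (E : poVectType R).
Implicit Types (mu : set X -> topped E).

(* Only the values of mu on Omega are meaningful. *)
Record is_measure mu : Prop := IsMeasure {
  is_measure_ge0 : forall D, Omega D -> fin 0 <= mu D ;
  is_measure0 : mu set0 = fin 0 ;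
  is_measure_bigcup : forall D : nat -> set X,
    (forall n, Omega (D n)) -> trivIset setT D ->
    supremums (range (fun N => \sum_(n < N.+1) mu (D n))) (mu (\bigcup_n D n))
}.

Definition finite_measure mu : Prop := mu setT <> infty.

(* The integral of phi = \sum_i r_i \1_(Delta_i), computed on the
   decomposition of phi into its level sets, as for [sintegral]. *)
Definition simple_oint mu (phi : X -> R) : topped E :=
  \sum_(r \in range phi) topped_scale r (mu (phi @^-1` [set r])).

(* For f : X -> [0, +oo]: the supremum of the integrals along some sequence
   of simple functions increasing pointwise to f; for measurable f such
   sequences exist and the supremum does not depend on their choice. *)
Definition oint mu (f : X -> \bar R) : topped E :=
  xget infty [set v | exists phi : nat -> X -> R,
    [/\ forall n, nonneg_simple Omega (phi n),
        forall x, increases_to (fun n => (phi n x)%:E) (f x) &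
        supremums (range (fun n => simple_oint mu (phi n))) v]].

Definition L1 mu : set (X -> R) :=
  [set f : X -> R | measurable_map Omega f /\
           oint mu (fun x => `|f x|%:E) <> infty].

Definition Iint mu (f : X -> R) : E :=
  fin_part (oint mu (EFin \o f^\+)) - fin_part (oint mu (EFin \o f^\-)).

End order_integral.

(* A set of functions forming a commutative, possibly non-unital, algebra. *)
Definition is_comm_fun_algebra (X : Type) (R : realType) (S : set (X -> R)) :
    Prop :=
  [/\ S \0,
      forall f g, S f -> S g -> S (f \+ g),
      forall (r : R) f, S f -> S (r \*o f),
      forall f g, S f -> S g -> S (f \* g) &
      forall f g, S f -> S g -> f \* g = g \* f].

Definition is_algebra_hom_on (X : Type) (R : realType) (A : poAlgType R)
    (S : set (X -> R)) (I : (X -> R) -> A) : Prop :=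
  [/\ forall f g, S f -> S g -> I (f \+ g) = I f + I g,
      forall (r : R) f, S f -> I (r \*o f) = r *: I f &
      forall f g, S f -> S g -> I (f \* g) = (I f * I g)%g].

Definition is_spectral (X : Type) (Omega : set (set X)) (R : realType)
    (A : poAlgType R) (mu : set X -> topped A) : Prop :=
  forall (D1 D2 : set X) (a1 a2 : A), Omega D1 -> Omega D2 ->
  mu D1 = fin a1 -> mu D2 = fin a2 -> mu (D1 `&` D2) = fin (a1 * a2)%g.

(* Main.v *)
(** If mu is spectral, expanding over level sets shows that the order integral
    is multiplicative on simple functions with finite integral.  Since products
    of increasing sequences in the positive cone have the product of the suprema
    as supremum, this passes to nonnegative integrable functions, and by
    splitting into positive and negative parts to all of L^1.  Conversely the
    integral of the indicator of D is mu D, so multiplicativity on indicators is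
    spectrality.  For finite mu with commuting idempotent values, disjoint D1
    and D2 satisfy 2 mu(D1) mu(D2) = 0, because mu(D1) + mu(D2) is idempotent;
    decomposing two arbitrary sets along their intersection gives
    spectrality. *)

Require Import Defs.
From HB Require Import structures.
From mathcomp Require Import all_boot all_order all_algebra.
From mathcomp Require Import all_classical all_reals all_analysis.
From mathcomp Require Import measurable_realfun ring lra.
Import Order.TTheory GRing.Theory Num.Theory.
Import numFieldNormedType.Exports.
Import HBNNSimple.
Set Implicit Arguments.
Unset Strict Implicit.
Unset Printing Implicit Defensive.
Local Open Scope classical_set_scope.
Local Open Scope ring_scope.

(** * Suprema in partially ordered vector spaces *)

Section increasing_limits.
Context d (T : porderType d).
Implicit Types (u : nat -> T) (x y : T).

Lemma increases_to_le u x n : increases_to u x -> (u n <= x)%O.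
Proof. by case=> _ [+ _]; apply; exists n. Qed.

Lemma increases_to_least u x y :
  increases_to u x -> (forall n, u n <= y)%O -> (x <= y)%O.
Proof. by case=> _ [_ +] uy; apply => _ [n _ <-]. Qed.

Lemma increases_to_intro u x : nondecreasing_seq u -> (forall n, u n <= x)%O ->
  (forall y, (forall n, u n <= y)%O -> (x <= y)%O) -> increases_to u x.
Proof.
move=> ndu ux xle; split=> //; split=> [_ [n _ <-]//|y uy].
by apply: xle => n; apply: uy; exists n.
Qed.

Lemma increases_to_cst x : increases_to (fun=> x) x.
Proof. by apply: increases_to_intro => // y xy; exact: (xy 0%N). Qed.

End increasing_limits.
Arguments increases_to_le {d T u x} n.

(** * Order and arithmetic in [E] and in [topped E] *)

Section partially_ordered_vector_space.
Context {R : realType} {E : poVectType R}.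
Implicit Types (a b c e : E) (x y z w : topped E) (r s : R).

Lemma pov_lerD a b c e : a <= b -> c <= e -> a + c <= b + e.
Proof.
move=> ab ce; apply: (le_trans (pov_leD2r c _ _ ab)).
by rewrite ![b + _]addrC; exact: pov_leD2r.
Qed.

Lemma pov_subr_ge0 a b : (0 <= a - b) = (b <= a).
Proof.
apply/idP/idP => h; first by have := pov_leD2r b _ _ h; rewrite add0r subrK.
by have := pov_leD2r (- b) _ _ h; rewrite subrr.
Qed.

Lemma pov_leBrDr a b c : (a <= b - c) = (a + c <= b).
Proof. by rewrite -pov_subr_ge0 -addrA -opprD pov_subr_ge0 addrC. Qed.

Lemma pov_scale_le r a b : 0 <= r -> a <= b -> r *: a <= r *: b.
Proof.
move=> r0; rewrite -[a <= b]pov_subr_ge0 => ab.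
by rewrite -pov_subr_ge0 -scalerBr; exact: pov_scale_ge0.
Qed.

Lemma le_infty x : x <= infty.
Proof. by case: x. Qed.

Lemma infty_le x : infty <= x -> x = infty.
Proof. by case: x. Qed.

Lemma le_fin a b : (fin a <= fin b) = (a <= b).
Proof. by []. Qed.

Lemma fin_inj a b : fin a = fin b -> a = b.
Proof. by case. Qed.

Lemma fin_partK x : x <> infty -> fin (fin_part x) = x.
Proof. by case: x. Qed.

Lemma finD a b : fin (a + b) = fin a + fin b.
Proof. by []. Qed.

Lemma topped_inftyD x : infty + x = infty.
Proof. by []. Qed.

Lemma topped_Dinfty x : x + infty = infty.
Proof. by case: x. Qed.

Lemma le_finite x y : x <= y -> y <> infty -> x <> infty.
Proof. by move=> + + xoo; rewrite xoo => /infty_le. Qed.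

Lemma topped_leD x y z w : x <= y -> z <= w -> x + z <= y + w.
Proof.
case: x y z w => [a|] [b|] [c|] [e|] //; rewrite ?topped_Dinfty ?le_infty //.
exact: pov_lerD.
Qed.

Lemma topped_sum_le (I : eqType) (r : seq I) (F G : I -> topped E) :
  (forall i, i \in r -> F i <= G i) ->
  \sum_(i <- r) F i <= \sum_(i <- r) G i.
Proof.
elim: r => [|i r ih] FG; first by rewrite !big_nil.
rewrite !big_cons; apply: topped_leD; first by rewrite FG// mem_head.
by apply: ih => j jr; rewrite FG// inE jr orbT.
Qed.

Lemma topped_sum_ge0 (I : eqType) (r : seq I) (F : I -> topped E) :
  (forall i, i \in r -> fin 0 <= F i) -> fin 0 <= \sum_(i <- r) F i.
Proof.
move=> F0; apply: le_trans (topped_sum_le F0).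
by rewrite big1_eq.
Qed.

Lemma topped_scale0 x : topped_scale 0 x = 0.
Proof. by case: x => [a|]/=; rewrite ?scale0r ?eqxx. Qed.

Lemma topped_scaler0 r : topped_scale r (0 : topped E) = 0.
Proof. by rewrite /= scaler0. Qed.

Lemma topped_scale1 x : topped_scale 1 x = x.
Proof. by case: x => [a|]/=; rewrite ?scale1r ?oner_eq0. Qed.

Lemma topped_scale_infty r : r != 0 -> topped_scale r (@infty E) = infty.
Proof. by move=> /negPf/= ->. Qed.

Lemma topped_scaleDr r x y :
  topped_scale r (x + y) = topped_scale r x + topped_scale r y.
Proof.
have [->|r0] := eqVneq r 0; first by rewrite !topped_scale0 addr0.
case: x y => [a|] [b|]; rewrite ?topped_Dinfty ?topped_scale_infty//.
by rewrite -!/(fin _) -finD /= scalerDr.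
Qed.

Lemma topped_scale_sum r (I : Type) (s : seq I) (F : I -> topped E) :
  topped_scale r (\sum_(i <- s) F i) = \sum_(i <- s) topped_scale r (F i).
Proof.
by apply: (big_morph _ (topped_scaleDr r)); exact: topped_scaler0.
Qed.

(* Fails for r = - s and x = infty. *)
Lemma topped_scaleDl r s x : 0 <= r -> 0 <= s ->
  topped_scale (r + s) x = topped_scale r x + topped_scale s x.
Proof.
move=> r0 s0; case: x => [a|] /=; first by rewrite scalerDl.
by rewrite paddr_eq0//; case: eqP; case: eqP => //; rewrite addr0.
Qed.

Lemma topped_scaleA r s x :
  topped_scale r (topped_scale s x) = topped_scale (r * s) x.
Proof.
have [->|r0] := eqVneq r 0; first by rewrite mul0r !topped_scale0.
have [->|s0] := eqVneq s 0; first by rewrite mulr0 topped_scale0 topped_scaler0.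
case: x => [a|]; first by rewrite /= scalerA.
by rewrite !topped_scale_infty ?mulf_neq0.
Qed.

Lemma topped_scale_le r x y : 0 <= r -> x <= y ->
  topped_scale r x <= topped_scale r y.
Proof.
have [->|r0] := eqVneq r 0; first by rewrite !topped_scale0.
move=> r_ge0; case: x y => [a|] [b|]//; rewrite ?topped_scale_infty ?le_infty//.
exact: pov_scale_le.
Qed.

Lemma topped_scale_ge0 r x : 0 <= r -> fin 0 <= x -> fin 0 <= topped_scale r x.
Proof.
by move=> r0 x0; have := topped_scale_le r0 x0; rewrite topped_scaler0.
Qed.

Lemma topped_scale_lel r s x : 0 <= r -> r <= s -> fin 0 <= x ->
  topped_scale r x <= topped_scale s x.
Proof.
move=> r0 rs x0; rewrite -(subrK r s) addrC topped_scaleDl ?subr_ge0//.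
by rewrite -[leLHS]addr0 topped_leD ?topped_scale_ge0 ?subr_ge0.
Qed.

(** For finite values a and b, the choice r = n / (n + 1) gives n a <= (n + 1) b, that is (n + 1) (a
    - b) <= a. As this holds for every n, the Archimedean axiom yields a - b <= 0. *)
Lemma topped_archimedean x y : fin 0 <= x ->
  (forall r, 0 <= r -> r < 1 -> topped_scale r x <= y) -> x <= y.
Proof.
move=> x0; case: y => [b|] xy; last exact: le_infty.
case: x x0 xy => [a|] a0 xy; last first.
  (* An infinite [x] stays infinite under any r strictly between 0 and 1, which contradicts the
     finite bound; 1/2 is one such r. *)
  have h0 : 0 <= 2^-1 :> R by rewrite invr_ge0.
  have h1 : 2^-1 < 1 :> R by rewrite invf_lt1// ltr1n.
  by have := xy _ h0 h1; rewrite topped_scale_infty// invr_eq0.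
rewrite le_fin -pov_subr_ge0 -opprB -[leRHS]add0r pov_subr_ge0.
apply: (@pov_archimedean R E a) => -[|n]; first by rewrite mulr0n.
have nn : n.+1%:R != 0 :> R by rewrite pnatr_eq0.
have c0 : 0 <= n%:R / n.+1%:R :> R by rewrite divr_ge0.
have c1 : n%:R / n.+1%:R < 1 :> R by rewrite ltr_pdivrMr// mul1r ltr_nat.
have /(pov_scale_le (ler0n _ n.+1)) := xy _ c0 c1.
rewrite scalerA mulrCA mulfV// mulr1 !scaler_nat => h.
rewrite mulrnBl -pov_subr_ge0 opprB addrCA (mulrS a) opprD.
by rewrite (addrA a) subrr add0r pov_subr_ge0.
Qed.

(** By monotonicity, an upper bound c of the diagonal sums bounds every [u m + v n]. When c is
    finite, the suprema are taken one at a time, over n and then over m, with a subtraction in [E]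
    in between. *)
Lemma increases_toD (u v : nat -> topped E) x y :
  increases_to u x -> increases_to v y ->
  increases_to (fun n => u n + v n) (x + y).
Proof.
move=> ux vy; apply: increases_to_intro => [m n mn|n|[c|] uvc].
- by apply: topped_leD; [apply ux.1|apply vy.1].
- by apply: topped_leD; exact: increases_to_le.
- have uvmn m n : u m + v n <= fin c.
    apply: le_trans (uvc (maxn m n)); apply: topped_leD.
      by apply: ux.1; rewrite leq_maxl.
    by apply: vy.1; rewrite leq_maxr.
  (* The finite bound forces [u m] to be finite, so it can be moved to the right before the supremum
     over n is taken. *)
  have uF m : exists2 a, u m = fin a & y <= fin (c - a).
    case Eu: (u m) => [a|]; last by have := uvmn m 0; rewrite Eu.
    exists a => //; apply: (increases_to_least vy) => n.
    have := uvmn m n; rewrite Eu; case: (v n) => [b|//].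
    by rewrite -!/(fin _) -finD !le_fin pov_leBrDr addrC.
  case: y vy uF => [b|] vy uF; last by have [a _ /infty_le] := uF 0.
  have : x <= fin (c - b).
    apply: (increases_to_least ux) => m; have [a -> +] := uF m.
    by rewrite !le_fin !pov_leBrDr addrC.
  case: x {ux} => [a|//].
  by rewrite -!/(fin _) -finD !le_fin pov_leBrDr.
- exact: le_infty.
Qed.

Lemma increases_to_scale r (u : nat -> topped E) x : 0 <= r ->
  increases_to u x ->
  increases_to (fun n => topped_scale r (u n)) (topped_scale r x).
Proof.
have [->|r0] := eqVneq r 0.
  move=> _ _; rewrite topped_scale0.
  by under eq_fun do rewrite topped_scale0; exact: increases_to_cst.
move=> r_ge0 ux; apply: increases_to_intro => [m n mn|n|y uy].
- by apply: topped_scale_le => //; apply ux.1.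
- by apply: topped_scale_le => //; exact: increases_to_le.
(* Here r is nonzero, so an upper bound [y] of the scaled sequence gives the upper bound y / r of
   the original one. *)
rewrite -(topped_scale1 y) -(mulfV r0) -topped_scaleA topped_scale_le//.
apply: (increases_to_least ux) => n.
rewrite -[leLHS]topped_scale1 -(mulVf r0) -topped_scaleA topped_scale_le//.
by rewrite invr_ge0.
Qed.

Lemma increases_to_sum (I : eqType) (s : seq I) (u : I -> nat -> topped E)
    (x : I -> topped E) : {in s, forall i, increases_to (u i) (x i)} ->
  increases_to (fun n => \sum_(i <- s) u i n) (\sum_(i <- s) x i).
Proof.
elim: s => [_|i s ih ux].
  by rewrite big_nil; under eq_fun do rewrite big_nil; exact: increases_to_cst.
rewrite big_cons; under eq_fun do rewrite big_cons.
apply: increases_toD; first by apply: ux; rewrite mem_head.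
by apply: ih => j js; apply: ux; rewrite inE js orbT.
Qed.

Lemma topped_sum_finite (I : eqType) (s : seq I) (F : I -> topped E) :
  \sum_(i <- s) F i <> infty -> {in s, forall i, F i <> infty}.
Proof.
by move=> + i is_ Fi; apply; rewrite (big_rem i)//= Fi topped_inftyD.
Qed.

Lemma increases_to_fin (u : nat -> E) a :
  increases_to (fun n => fin (u n)) (fin a) <-> increases_to u a.
Proof.
split=> ua; apply: increases_to_intro.
- by move=> m n /ua.1.
- by move=> n; have := increases_to_le n ua.
- by move=> b ub; rewrite -le_fin; exact: (increases_to_least ua).
- by move=> m n /ua.1.
- by move=> n; have := increases_to_le n ua.
- move=> [b|] ub; last exact: le_infty.
  by rewrite le_fin; exact: (increases_to_least ua).
Qed.

(** Either some finite element bounds the sequence, which then lives in [E] and has a supremum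
    there, or [infty] is its only upper bound. *)
Lemma increases_to_ex (u : nat -> topped E) : sigma_monotone_complete E ->
  nondecreasing_seq u -> exists x, increases_to u x.
Proof.
move=> cE ndu; have [[a ua]|nua] := pselect (exists a, forall n, u n <= fin a).
  have uF n : u n = fin (fin_part (u n)).
    by rewrite fin_partK//; exact: le_finite (ua n) _.
  have ndF : nondecreasing_seq (fun n => fin_part (u n)).
    by move=> m n /ndu; rewrite (uF m) (uF n).
  have [b ub] : exists b, supremums (range (fun n => fin_part (u n))) b.
    by apply: cE => //; exists a => _ [n _ <-]; rewrite -le_fin -uF.
  by exists (fin b); rewrite (funext uF); apply/increases_to_fin.
exists infty; apply: increases_to_intro => // [n|[b|] ub].
- exact: le_infty.
- by case: nua; exists b.
- exact: le_infty.
Qed.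

End partially_ordered_vector_space.

(** * Measurable maps *)

Section measurable_maps.
Context {X : Type} {Omega : set (set X)}.
Context (HOmega : sigma_algebra [set: X] Omega).

Lemma sigma_algebra_empty : Omega set0.
Proof. by case: HOmega. Qed.

Lemma sigma_algebra_compl D : Omega D -> Omega (~` D).
Proof. by case: HOmega => _ + _ => /(_ D) /[apply]; rewrite setTD. Qed.

Lemma sigma_algebra_union (D : nat -> set X) :
  (forall n, Omega (D n)) -> Omega (\bigcup_n D n).
Proof. by case: HOmega => _ _; exact. Qed.

Lemma sigma_algebra_setT : Omega setT.
Proof. by rewrite -setC0; exact/sigma_algebra_compl/sigma_algebra_empty. Qed.

Lemma sigma_algebra_setU D1 D2 : Omega D1 -> Omega D2 -> Omega (D1 `|` D2).
Proof.
move=> m1 m2; rewrite -bigcup2E; apply: sigma_algebra_union => -[|[|n]] //=.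
exact: sigma_algebra_empty.
Qed.

Lemma sigma_algebra_setI D1 D2 : Omega D1 -> Omega D2 -> Omega (D1 `&` D2).
Proof.
move=> m1 m2; rewrite -(setCK (D1 `&` D2)) setCI; apply: sigma_algebra_compl.
by apply: sigma_algebra_setU; exact: sigma_algebra_compl.
Qed.

Lemma sigma_algebra_setD D1 D2 : Omega D1 -> Omega D2 -> Omega (D1 `\` D2).
Proof.
by move=> m1 m2; apply: sigma_algebra_setI => //; exact: sigma_algebra_compl.
Qed.

Section maps.
Context {d d' : measure_display} {Y : measurableType d} {Z : measurableType d'}.

Lemma measurable_map_comp (f : X -> Y) (h : Y -> Z) : measurable_map Omega f ->
  measurable_fun setT h -> measurable_map Omega (h \o f).
Proof.
move=> mf mh B mB; apply: (mf (h @^-1` B)).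
by rewrite -[_ @^-1` _]setTI; exact: (mh measurableT).
Qed.

(** The sets whose preimage lies in [Omega] form a sigma-algebra, and it contains the preimages
    under the two projections, which generate the product. *)
Lemma measurable_map_pair (f : X -> Y) (g : X -> Z) : measurable_map Omega f ->
  measurable_map Omega g -> measurable_map Omega (fun x => (f x, g x)).
Proof.
move=> mf mg; apply: smallest_sub.
  split => /=; first exact: sigma_algebra_empty.
    by move=> D mD; rewrite setTD; exact: sigma_algebra_compl.
  by move=> D mD; rewrite preimage_bigcup; exact: sigma_algebra_union.
rewrite subUset; split=> _ [B mB <-] /=; rewrite setTI.
  exact: mf mB.
exact: mg mB.
Qed.

End maps.

Lemma measurable_map_indic (R : realType) D :
  Omega D -> measurable_map Omega (\1_D : X -> R).
Proof.
move=> mD B _; rewrite preimage_indic; case: ifPn => _; case: ifPn => _ //.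
- exact: sigma_algebra_setT.
- exact: sigma_algebra_compl.
- exact: sigma_algebra_empty.
Qed.

(** * Real-valued measurable functions and nonnegative simple functions *)

Context {R : realType}.
Implicit Types (f g phi psi : X -> R).

(** Transfers to functions on [X] the measurability of binary operations, known on [R * R]. *)
Lemma measurable_map_op (h : R * R -> R) f g : measurable_fun setT h ->
  measurable_map Omega f -> measurable_map Omega g ->
  measurable_map Omega (fun x => h (f x, g x)).
Proof.
by move=> mh mf mg; exact: measurable_map_comp (measurable_map_pair mf mg) mh.
Qed.

Lemma measurable_mapD f g : measurable_map Omega f -> measurable_map Omega g ->
  measurable_map Omega (f \+ g).
Proof.
apply: (@measurable_map_op (fun t => t.1 + t.2)).
exact: measurable_funD measurable_fst measurable_snd.
Qed.

Lemma measurable_mapM f g : measurable_map Omega f -> measurable_map Omega g ->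
  measurable_map Omega (f \* g).
Proof.
apply: (@measurable_map_op (fun t => t.1 * t.2)).
exact: measurable_funM measurable_fst measurable_snd.
Qed.

Lemma measurable_mapZ r f : measurable_map Omega f ->
  measurable_map Omega (r \*o f).
Proof.
by move=> mf; exact: measurable_map_comp mf (mulrl_measurable r).
Qed.

Lemma measurable_map_pos f :
  measurable_map Omega f -> measurable_map Omega f^\+.
Proof.
have mh : measurable_fun setT (fun r : R => Num.max r 0).
  exact: measurable_maxr.
by move=> mf; exact: measurable_map_comp mf mh.
Qed.

Lemma measurable_map_neg f :
  measurable_map Omega f -> measurable_map Omega f^\-.
Proof.
have mh : measurable_fun setT (fun r : R => Num.max (- r) 0).
  by apply: measurable_maxr => //; exact: oppr_measurable.
by move=> mf; exact: measurable_map_comp mf mh.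
Qed.

Lemma measurable_map_abs f :
  measurable_map Omega f -> measurable_map Omega (fun x => `|f x|).
Proof.
by move=> mf; exact: measurable_map_comp mf (@normr_measurable R setT).
Qed.

Lemma measurable_map_le f g : measurable_map Omega f ->
  measurable_map Omega g -> Omega [set x | f x <= g x].
Proof.
move=> mf mg; have mh : measurable_fun setT (fun t : R * R => t.1 <= t.2).
  exact: measurable_fun_ler measurable_fst measurable_snd.
have := measurable_map_comp (measurable_map_pair mf mg) mh.
by move=> /(_ [set true]); apply.
Qed.

Lemma nonneg_simple_op (h : R * R -> R) phi psi : measurable_fun setT h ->
  (forall t, 0 <= t.1 -> 0 <= t.2 -> 0 <= h t) ->
  nonneg_simple Omega phi -> nonneg_simple Omega psi ->
  nonneg_simple Omega (fun x => h (phi x, psi x)).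
Proof.
move=> mh h0 [mphi fphi phi0] [mpsi fpsi psi0]; split.
- exact: measurable_map_op.
- exact: (finite_image11 (fun a b => h (a, b))).
- by move=> x; apply: h0; [exact: phi0|exact: psi0].
Qed.

Lemma nonneg_simpleD phi psi : nonneg_simple Omega phi ->
  nonneg_simple Omega psi -> nonneg_simple Omega (phi \+ psi).
Proof.
apply: (@nonneg_simple_op (fun t => t.1 + t.2)).
  exact: measurable_funD measurable_fst measurable_snd.
by move=> t; exact: addr_ge0.
Qed.

Lemma nonneg_simpleM phi psi : nonneg_simple Omega phi ->
  nonneg_simple Omega psi -> nonneg_simple Omega (phi \* psi).
Proof.
apply: (@nonneg_simple_op (fun t => t.1 * t.2)).
  exact: measurable_funM measurable_fst measurable_snd.
by move=> t; exact: mulr_ge0.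
Qed.

Lemma nonneg_simpleZ r phi : 0 <= r -> nonneg_simple Omega phi ->
  nonneg_simple Omega (r \*o phi).
Proof.
move=> r0 [mphi fphi phi0]; split; first exact: measurable_mapZ.
  by rewrite -(image_comp phi ( *%R r)); exact: finite_image.
by move=> x; exact: mulr_ge0.
Qed.

Lemma nonneg_simple_indic D : Omega D -> nonneg_simple Omega (\1_D : X -> R).
Proof.
move=> mD; split=> //; first exact: measurable_map_indic.
by apply: (@sub_finite_set _ _ [set 0; 1]) => // _ [x _ <-]; rewrite /= indicE;
  case: (_ \in _); [right|left].
Qed.

Lemma nonneg_simple_level phi r :
  nonneg_simple Omega phi -> Omega (phi @^-1` [set r]).
Proof. by case=> mphi _ _; exact: mphi. Qed.

(** With its converse [increases_to_cvg], this lets the limit theorems for real sums and products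
    serve for pointwise suprema of simple functions. *)
Lemma nondecreasing_cvg_increases_to (u : nat -> R) (l : R) :
  nondecreasing_seq u -> u @ \oo --> l -> increases_to u l.
Proof.
move=> ndu ul; apply: increases_to_intro => // [n|y uy].
  rewrite -(cvg_lim (@Rhausdorff R) ul); apply: nondecreasing_cvgn_le => //.
  by apply/cvg_ex; exists l.
rewrite -(cvg_lim (@Rhausdorff R) ul); apply: limr_le; last exact: nearW.
by apply/cvg_ex; exists l.
Qed.

Lemma increases_to_cvg (u : nat -> R) (l : R) :
  increases_to u l -> u @ \oo --> l.
Proof.
move=> ul; have uub : has_ubound (range u).
  by exists l => _ [n _ <-]; exact: increases_to_le.
have := nondecreasing_cvgn ul.1 uub.
suff -> : sup (range u) = l by [].
apply/le_anti/andP; split.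
  apply: ge_sup; first by exists (u 0%N), 0%N.
  by move=> _ [n _ <-]; exact: increases_to_le.
by apply: (increases_to_least ul) => n; apply: ub_le_sup => //; exists n.
Qed.

Lemma increases_to_EFin (u : nat -> R) (l : R) :
  increases_to (fun n => (u n)%:E) l%:E <-> increases_to u l.
Proof.
split=> ul; apply: increases_to_intro.
- by move=> m n /ul.1.
- by move=> n; have := increases_to_le n ul.
- by move=> y uy; rewrite -lee_fin; exact: (increases_to_least ul).
- by move=> m n /ul.1; rewrite lee_fin.
- by move=> n; rewrite lee_fin; exact: increases_to_le.
- move=> [y| |] uy; rewrite ?leey//.
    by rewrite lee_fin; exact: (increases_to_least ul).
  by have := uy 0%N.
Qed.

(* X carries no measurableType structure, so the approximation of |.| on R is
   pulled back along f. *)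
Lemma nonneg_simple_approx f : measurable_map Omega f -> (forall x, 0 <= f x) ->
  exists2 phi : nat -> X -> R, forall n, nonneg_simple Omega (phi n) &
    forall x, increases_to (phi ^~ x) (f x).
Proof.
move=> mf f0; have mE : measurable_fun setT (EFin \o (@Num.norm R R)).
  by apply/measurable_EFinP; exact: normr_measurable.
pose h n := nnsfun_approx measurableT mE n.
have ndh : nondecreasing_seq (fun n => h n : R -> R) by exact: nd_nnsfun_approx.
exists (fun n => h n \o f) => [n|x]; first split.
- exact: measurable_map_comp.
- by apply: sub_finite_set (fimfunP (h n)) => _ [y _ <-]; exists (f y).
- by move=> x /=.
apply: nondecreasing_cvg_increases_to => [m n mn|].
  exact: (lef_at (f x) ndh mn).
rewrite -[X in _ --> X]ger0_norm//.
have nE0 (r : R) : [set: R] r -> (0 <= (EFin \o Num.norm) r)%E.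
  by move=> _; rewrite lee_fin.
by have /fine_cvgP[_] := cvg_nnsfun_approx measurableT mE nE0 (x := f x) I.
Qed.

End measurable_maps.

(** * The order integral *)

Local Notation elems A := (finmap.enum_fset (fset_set A)).

(** After exchanging the sums, each i is counted once, at j = h i. This regroups a sum over level
    sets of one function by the values of another. *)
Lemma sum_fibers (V : nmodType) (I J : eqType) (s : seq I) (t : seq J)
    (h : I -> J) (F : I -> V) : uniq t -> {in s, forall i, h i \in t} ->
  \sum_(j <- t) \sum_(i <- s | h i == j) F i = \sum_(i <- s) F i.
Proof.
move=> ut hs; rewrite (exchange_big_dep xpredT)//=; apply: eq_big_seq => i is_.
rewrite -big_filter (eq_filter (a2 := pred1 (h i))); last first.
  by move=> j /=; rewrite eq_sym.
by rewrite filter_pred1_uniq ?hs// big_seq1.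
Qed.

Section order_integral_theory.
Context {X : Type} {Omega : set (set X)} {R : realType} {E : poVectType R}.
Context {mu : set X -> topped E}.
Context (HOmega : sigma_algebra [set: X] Omega) (Hmu : is_measure Omega mu).
Implicit Types (D : set X) (f g phi psi : X -> R) (r : R).

(** * Finite additivity and continuity from below of the measure *)

Lemma measure_setU D1 D2 : Omega D1 -> Omega D2 -> D1 `&` D2 = set0 ->
  mu (D1 `|` D2) = mu D1 + mu D2.
Proof.
move=> m1 m2 d12.
have mD n : Omega (bigcup2 D1 D2 n).
  by case: n => [|[|n]] //=; exact: sigma_algebra_empty.
have sumE N : \sum_(n < N.+2) mu (bigcup2 D1 D2 n) = mu D1 + mu D2.
  rewrite !big_ord_recl/= big1 ?addr0// => i _.
  exact: (is_measure0 Hmu).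
have := is_measure_bigcup Hmu mD; rewrite -trivIset_bigcup2 => /(_ d12).
rewrite bigcup2E => -[ub lub]; apply/le_anti/andP; split.
  (* The partial sum for N = 0 is [mu D1] alone and is bounded by positivity of [mu D2]; from N = 1
     on the partial sums are constant. *)
  apply: lub => _ [[|N] _ <-]; last by rewrite sumE.
  rewrite big_ord_recl big_ord0 /= addr0 -[leLHS]addr0.
  by apply: topped_leD => //; exact: (is_measure_ge0 Hmu).
by apply: ub; exists 1%N => //; rewrite sumE.
Qed.

Lemma measure_le D1 D2 : Omega D1 -> Omega D2 -> D1 `<=` D2 -> mu D1 <= mu D2.
Proof.
move=> m1 m2 s12; have m21 := sigma_algebra_setD HOmega m2 m1.
rewrite -(setDUK s12) measure_setU ?setDIK// -[leLHS]addr0.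
by apply: topped_leD => //; exact: (is_measure_ge0 Hmu).
Qed.

(** The successive differences [seqD D] are disjoint with the same union, and the partial sums of
    their measures collapse to [mu (D N)]. *)
Lemma measure_increases_to (D : nat -> set X) : (forall n, Omega (D n)) ->
  {homo D : m n / (m <= n)%N >-> m `<=` n} ->
  increases_to (mu \o D) (mu (\bigcup_n D n)).
Proof.
move=> mD ndD.
have ndD' : nondecreasing_seq D by move=> m n mn; apply/subsetPset; exact: ndD.
have mseqD n : Omega (seqD D n).
  by case: n => [|n] //=; exact: sigma_algebra_setD.
have sumE N : \sum_(n < N.+1) mu (seqD D n) = mu (D N).
  elim: N => [|N ih]; first by rewrite big_ord_recl big_ord0 addr0.
  rewrite big_ord_recr /= ih -measure_setU ?setDIK//; last exact: (mseqD N.+1).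
  by rewrite setDUK//; exact: ndD.
split; first by move=> m n mn; apply: measure_le => //; exact: ndD.
have := is_measure_bigcup Hmu mseqD (trivIset_seqD ndD').
by rewrite eq_bigcup_seqD (funext sumE).
Qed.

Lemma measure_preimage_seq (T : choiceType) (g : X -> T) (s : seq T) :
  (forall t, Omega (g @^-1` [set t])) -> uniq s ->
  Omega [set x | g x \in s] /\
  mu [set x | g x \in s] = \sum_(t <- s) mu (g @^-1` [set t]).
Proof.
move=> mg; elim: s => [_|t s ih /= /andP[ts /ih[ms mus]]].
  rewrite big_nil (_ : [set x | _] = set0); last by apply/seteqP; split.
  by split; [exact: sigma_algebra_empty|exact: (is_measure0 Hmu)].
have -> : [set x | g x \in t :: s] = g @^-1` [set t] `|` [set x | g x \in s].
  apply/seteqP; split=> x /=; rewrite inE; first by case/predU1P; [left|right].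
  by case=> [->|->]; rewrite ?eqxx ?orbT.
split; first exact: sigma_algebra_setU.
rewrite big_cons measure_setU// ?mus//; apply/seteqP; split=> // x /= [->].
by rewrite (negPf ts).
Qed.

(* The integral may be computed on any partition refining the level sets; this
   gives additivity by passing to the joint level sets of two functions. *)
Lemma simple_oint_comp (T : choiceType) (g : X -> T) (h : T -> R) :
  finite_set (range g) -> (forall t, Omega (g @^-1` [set t])) ->
  simple_oint mu (h \o g) = \sum_(t <- elems (range g))
    topped_scale (h t) (mu (g @^-1` [set t])).
Proof.
move=> fg mg; have fhg : finite_set (range (h \o g)).
  by rewrite -(image_comp g h); exact: finite_image.
rewrite /simple_oint fsbig_finite//; set s := elems (range g).
transitivity (\sum_(r <- elems (range (h \o g))) \sum_(t <- s | h t == r)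
    topped_scale (h t) (mu (g @^-1` [set t]))).
  apply: eq_big_seq => r _.
  (* A level set of [h \o g] is the disjoint union of the level sets of [g] over one fibre of [h];
     [measure_preimage_seq] adds up their measures. *)
  have -> : (h \o g) @^-1` [set r] = [set x | g x \in [seq t <- s | h t == r]].
    apply/seteqP; split=> x /=; rewrite mem_filter.
      by move=> ->; rewrite eqxx in_fset_set//= inE; exists x.
    by case/andP => /eqP.
  have us : uniq [seq t <- s | h t == r] by exact/filter_uniq/finmap.fset_uniq.
  rewrite (measure_preimage_seq mg us).2.
  by rewrite topped_scale_sum big_filter; apply: eq_bigr => t /eqP ->.
apply: sum_fibers; first exact: finmap.fset_uniq.
move=> t; rewrite in_fset_set// inE => -[x _ gxt].
by rewrite in_fset_set// inE; exists x => //=; rewrite gxt.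
Qed.

(** * Additivity and monotonicity of the simple integral *)

Section two_simple_functions.
Context {phi psi : X -> R}.
Context (sphi : nonneg_simple Omega phi) (spsi : nonneg_simple Omega psi).

Let g x : R * R := (phi x, psi x).

Lemma finite_range_pair : finite_set (range g).
Proof.
case: sphi spsi => _ fphi _ [_ fpsi _].
exact: (finite_image11 pair).
Qed.

Lemma level_set_pair t :
  g @^-1` [set t] = (phi @^-1` [set t.1]) `&` (psi @^-1` [set t.2]).
Proof.
apply/seteqP; split=> x /=; first by move=> <-.
by case: t => a b [/= <- <-].
Qed.

Lemma measurable_level_set_pair t : Omega (g @^-1` [set t]).
Proof.
by rewrite level_set_pair; apply: sigma_algebra_setI => //;
  exact: nonneg_simple_level.
Qed.

(** Taking for [h] the sum, [fst] or [snd] turns all the integrals involved into sums over the same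
    joint level sets, to be compared term by term. *)
Lemma simple_oint_pair (h : R * R -> R) :
  simple_oint mu (fun x => h (phi x, psi x)) =
  \sum_(t <- elems (range g)) topped_scale (h t)
    (mu ((phi @^-1` [set t.1]) `&` (psi @^-1` [set t.2]))).
Proof.
rewrite -[LHS]/(simple_oint mu (h \o g)) simple_oint_comp.
- by apply: eq_bigr => t _; rewrite level_set_pair.
- exact: finite_range_pair.
- exact: measurable_level_set_pair.
Qed.

(** The terms are compared at attained pairs, where the coefficients are nonnegative and a pointwise
    inequality between the functions applies to the coordinates. *)
Lemma mem_range_pair t : t \in elems (range g) ->
  [/\ 0 <= t.1, 0 <= t.2 & exists x, t = g x].
Proof.
rewrite in_fset_set ?inE; last exact: finite_range_pair.
case=> x _ <-; case: sphi spsi => _ _ phi0 [_ _ psi0].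
by split; [exact: phi0|exact: psi0|exists x].
Qed.

Lemma measure_level_set_pair_ge0 (t : R * R) :
  fin 0 <= mu ((phi @^-1` [set t.1]) `&` (psi @^-1` [set t.2])).
Proof.
apply: (is_measure_ge0 Hmu); rewrite -level_set_pair.
exact: measurable_level_set_pair.
Qed.

Lemma simple_ointD :
  simple_oint mu (phi \+ psi) = simple_oint mu phi + simple_oint mu psi.
Proof.
rewrite (simple_oint_pair (fun t => t.1 + t.2)) (simple_oint_pair fst).
rewrite (simple_oint_pair snd) -big_split.
by apply: eq_big_seq => t /mem_range_pair[t1 t2 _]; rewrite topped_scaleDl.
Qed.

Lemma simple_oint_le : (forall x, phi x <= psi x) ->
  simple_oint mu phi <= simple_oint mu psi.
Proof.
move=> le_phi_psi; rewrite (simple_oint_pair fst) (simple_oint_pair snd).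
apply: topped_sum_le => t /mem_range_pair[t1 t2 [x tx]].
apply: topped_scale_lel => //; last exact: measure_level_set_pair_ge0.
by rewrite tx /g /=.
Qed.

End two_simple_functions.

Lemma simple_ointZ r phi : nonneg_simple Omega phi ->
  simple_oint mu (r \*o phi) = topped_scale r (simple_oint mu phi).
Proof.
move=> sphi; have [_ fphi _] := sphi.
have mphi t : Omega (phi @^-1` [set t]) by exact: nonneg_simple_level.
rewrite (simple_oint_comp ( *%R r) fphi mphi).
rewrite (simple_oint_comp id fphi mphi) topped_scale_sum.
by apply: eq_bigr => t _; rewrite topped_scaleA.
Qed.

Lemma simple_oint_ge0 phi : nonneg_simple Omega phi ->
  fin 0 <= simple_oint mu phi.
Proof.
move=> sphi; have [_ fphi phi0] := sphi.
have mphi t : Omega (phi @^-1` [set t]) by exact: nonneg_simple_level.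
rewrite (simple_oint_comp id fphi mphi); apply: topped_sum_ge0 => t.
rewrite in_fset_set// inE => -[x _ <-]; apply: topped_scale_ge0 => //.
exact: (is_measure_ge0 Hmu).
Qed.

(** The indicator factors through membership in [bool], so there are at most two terms, and the one
    for [false] has coefficient 0. *)
Lemma simple_oint_indic D : Omega D -> simple_oint mu (\1_D : X -> R) = mu D.
Proof.
move=> mD; pose g x := x \in D.
have gT : g @^-1` [set true] = D.
  by apply/seteqP; split=> x; [exact: set_mem|exact: mem_set].
have gF : g @^-1` [set false] = ~` D.
  apply/seteqP; split=> x; last exact: memNset.
  by rewrite /g /= => + Dx; rewrite mem_set.
have mg t : Omega (g @^-1` [set t]).
  by case: t; rewrite ?gT ?gF//; exact: sigma_algebra_compl.
have fg : finite_set (range g) by exact: finite_finset.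
rewrite -[LHS]/(simple_oint mu ((fun b : bool => b%:R) \o g)).
rewrite simple_oint_comp//.
rewrite (bigID (pred1 true)) /= [X in _ + X]big1 ?addr0; last first.
  by case=> //= _; rewrite topped_scale0.
(* If [D] is empty, [true] is not attained and its term is missing from the sum; both sides are then
   0. *)
have [[x Dx]|nD] := pselect (D !=set0).
  rewrite -big_filter filter_pred1_uniq ?finmap.fset_uniq//; last first.
    by rewrite in_fset_set// inE; exists x => //; exact: mem_set.
  by rewrite big_seq1 topped_scale1 gT.
have D0 : D = set0 by apply/eqP/negPn/negP => /set0P.
rewrite big1 => [|t /eqP ->]; last first.
  by rewrite gT D0 (is_measure0 Hmu) topped_scaler0.
by rewrite D0 (is_measure0 Hmu).
Qed.

(** Follows by induction from linearity, for sets that may overlap. It evaluates truncated simple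
    functions in [simple_oint_le_sup] and products in [simple_oint_mul]. *)
Lemma simple_oint_sum_indic (I : eqType) (s : seq I) (r : I -> R)
    (D : I -> set X) : (forall i, i \in s -> 0 <= r i) ->
  (forall i, Omega (D i)) ->
  nonneg_simple Omega (fun x => \sum_(i <- s) r i * \1_(D i) x) /\
  simple_oint mu (fun x => \sum_(i <- s) r i * \1_(D i) x) =
    \sum_(i <- s) topped_scale (r i) (mu (D i)).
Proof.
move=> + mD; elim: s => [_|i s ih rs].
  have -> : (fun x => \sum_(i <- [::]) r i * \1_(D i) x) = \1_set0.
    by apply/funext => x; rewrite big_nil indicE in_set0.
  have m0 := sigma_algebra_empty HOmega.
  split; first exact: nonneg_simple_indic.
  by rewrite simple_oint_indic// big_nil (is_measure0 Hmu).
have [//|sS Ss] := ih; first by move=> j js; rewrite rs// inE js orbT.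
have ri : 0 <= r i by rewrite rs// mem_head.
have sD : nonneg_simple Omega (\1_(D i) : X -> R) by exact: nonneg_simple_indic.
have -> : (fun x => \sum_(j <- i :: s) r j * \1_(D j) x) =
    (r i \*o \1_(D i)) \+ (fun x => \sum_(j <- s) r j * \1_(D j) x).
  by apply/funext => x; rewrite big_cons.
have sZ := nonneg_simpleZ ri sD.
split; first exact: nonneg_simpleD.
by rewrite big_cons simple_ointD// Ss simple_ointZ// simple_oint_indic.
Qed.

Lemma simple_function_sum phi x : nonneg_simple Omega phi ->
  phi x = \sum_(r <- elems (range phi)) r * \1_(phi @^-1` [set r]) x.
Proof.
case=> _ fphi _; rewrite (bigD1_seq (phi x)) ?finmap.fset_uniq//=; last first.
  by rewrite in_fset_set// inE; exists x.
rewrite big1 ?addr0 => [|r rx].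
  by rewrite indicE mem_set// mulr1.
by rewrite indicE memNset ?mulr0// => /= xr; rewrite xr eqxx in rx.
Qed.

(* For c < 1 the sets where c * psi <= phi n increase to X, which bounds
   c * simple_oint mu psi; the Archimedean property then lets c tend to 1. *)
Lemma simple_oint_le_sup (phi : nat -> X -> R) psi (v : topped E) :
  (forall n, nonneg_simple Omega (phi n)) -> nonneg_simple Omega psi ->
  (forall x, nondecreasing_seq (phi ^~ x)) ->
  (forall x y, (forall n, phi n x <= y) -> psi x <= y) ->
  (forall n, simple_oint mu (phi n) <= v) -> simple_oint mu psi <= v.
Proof.
move=> sphi spsi ndphi psi_le phi_v.
apply: topped_archimedean => [|c c0 c1]; first exact: simple_oint_ge0.
have [mpsi fpsi psi0] := spsi.
have mphi n : measurable_map Omega (phi n) by case: (sphi n).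
pose D n := [set x | c * psi x <= phi n x].
have mD n : Omega (D n).
  exact (measurable_map_le HOmega (measurable_mapZ c mpsi) (mphi n)).
have ndD : {homo D : m n / (m <= n)%N >-> m `<=` n}.
  by move=> m n mn x /= /le_trans; apply; exact: ndphi.
have DT : \bigcup_n D n = setT.
  apply/seteqP; split=> // x _.
  have [psix0|psix0] := eqVneq (psi x) 0.
    by exists 0%N => //=; rewrite /D /= psix0 mulr0; case: (sphi 0%N).
  (* If [x] were in no [D n], then [c * psi x] would bound all [phi n x], hence also [psi x], which
     is impossible for c < 1 and [psi x] positive. *)
  apply: contrapT => /= nD; have : psi x <= c * psi x.
    apply: psi_le => n; rewrite leNgt; apply/negP => h; apply: nD.
    by exists n => //; exact: ltW.
  by apply/negP; rewrite -ltNge gtr_pMl// lt_def psix0 psi0.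
pose s := elems (range psi).
pose Dr n r := psi @^-1` [set r] `&` D n.
have mpsir r : Omega (psi @^-1` [set r]) by exact: nonneg_simple_level.
have mDr n r : Omega (Dr n r) by exact: sigma_algebra_setI.
have s0 r : r \in s -> 0 <= c * r.
  by rewrite in_fset_set// inE => -[x _ <-]; exact: mulr_ge0.
(* This is continuity from below of [mu] along [D n], applied inside each level set of [psi]. *)
have lim : increases_to
    (fun n => \sum_(r <- s) topped_scale (c * r) (mu (Dr n r)))
    (topped_scale c (simple_oint mu psi)).
  rewrite (simple_oint_comp id fpsi mpsir) topped_scale_sum.
  under eq_bigr do rewrite topped_scaleA.
  apply: increases_to_sum => r rs; apply: increases_to_scale; first exact: s0.
  have := measure_increases_to (fun n => mDr n r).
  rewrite -setI_bigcupr DT setIT; apply=> m n mn x [xr /= xD].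
  by split=> //; exact: ndD xD.
apply: (increases_to_least lim) => n; apply: le_trans (phi_v n).
(* The sum is the integral of c psi cut off outside [D n], a simple function below [phi n]. *)
have [sS <-] := simple_oint_sum_indic s0 (mDr n); apply: simple_oint_le => // x.
under eq_bigr do rewrite indicI mulrA -(mulrA c).
rewrite -mulr_suml -mulr_sumr -simple_function_sum// indicE.
case: (boolP (x \in D n)) => [/set_mem xD|_]; first by rewrite mulr1.
by rewrite mulr0; case: (sphi n).
Qed.

(** * The order integral of nonnegative measurable functions *)

Local Notation oi f := (oint Omega mu (EFin \o f)).

Lemma simple_oint_nondecreasing (phi : nat -> X -> R) :
  (forall n, nonneg_simple Omega (phi n)) ->
  (forall x, nondecreasing_seq (phi ^~ x)) ->
  nondecreasing_seq (fun n => simple_oint mu (phi n)).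
Proof.
by move=> sphi ndphi m n mn; apply: simple_oint_le => // x; exact: ndphi.
Qed.

(** The sequence [phi] rules out the default of [xget], which therefore returns the supremum w for
    some sequence psi. Each [psi n] is below the pointwise supremum of [phi] and conversely, so
    [simple_oint_le_sup] used both ways gives w = v. *)
Lemma ointE (phi : nat -> X -> R) f (v : topped E) :
  (forall n, nonneg_simple Omega (phi n)) ->
  (forall x, increases_to (phi ^~ x) (f x)) ->
  increases_to (fun n => simple_oint mu (phi n)) v -> oi f = v.
Proof.
move=> sphi phif phiv; rewrite /oint; case: xgetP => [w _|/(_ v)[]]; last first.
  by exists phi; split; [|move=> x; apply/increases_to_EFin|exact: phiv.2].
move=> [psi [spsi psif psiw]].
have {}psif x : increases_to (psi ^~ x) (f x) by apply/increases_to_EFin/psif.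
have {}psiw : increases_to (fun n => simple_oint mu (psi n)) w.
  split=> //; apply: simple_oint_nondecreasing => // x.
  by have [] := psif x.
apply/le_anti/andP; split.
  apply: (increases_to_least psiw) => n.
  apply: (simple_oint_le_sup sphi) => // [x|x y phiy|m].
  - by have [] := phif x.
  - apply: le_trans (increases_to_least (phif x) phiy).
    exact: (increases_to_le n (psif x)).
  - exact: (increases_to_le m phiv).
apply: (increases_to_least phiv) => n.
apply: (simple_oint_le_sup spsi) => // [x|x y psiy|m].
- by have [] := psif x.
- apply: le_trans (increases_to_least (psif x) psiy).
  exact: (increases_to_le n (phif x)).
- exact: (increases_to_le m psiw).
Qed.

Context (HE : sigma_monotone_complete E).

(** Completeness provides a supremum, possibly infinite, for the integrals of an approximating
    sequence. Later arguments work with such sequences instead of the choice made by [xget]. *)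
Lemma oint_approx f : measurable_map Omega f -> (forall x, 0 <= f x) ->
  exists phi : nat -> X -> R,
    [/\ forall n, nonneg_simple Omega (phi n),
        forall x, increases_to (phi ^~ x) (f x) &
        increases_to (fun n => simple_oint mu (phi n)) (oi f)].
Proof.
move=> mf f0; have [phi sphi phif] := nonneg_simple_approx mf f0.
have [|v phiv] := increases_to_ex HE (u := fun n => simple_oint mu (phi n)).
  by apply: simple_oint_nondecreasing => // x; have [] := phif x.
by exists phi; split=> //; rewrite (ointE sphi phif phiv).
Qed.

Lemma oint_le f g : measurable_map Omega f -> measurable_map Omega g ->
  (forall x, 0 <= f x) -> (forall x, f x <= g x) -> oi f <= oi g.
Proof.
move=> mf mg f0 fg; have g0 x : 0 <= g x by exact: le_trans (fg x).
have [phi [sphi phif phiv]] := oint_approx mf f0.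
have [psi [spsi psig psiv]] := oint_approx mg g0.
apply: (increases_to_least phiv) => n.
apply: (simple_oint_le_sup spsi) => // [x|x y psiy|m].
- by have [] := psig x.
- apply: le_trans (increases_to_least (psig x) psiy).
  by apply: le_trans (fg x); exact: (increases_to_le n (phif x)).
- exact: (increases_to_le m psiv).
Qed.

Lemma ointD f g : measurable_map Omega f -> measurable_map Omega g ->
  (forall x, 0 <= f x) -> (forall x, 0 <= g x) -> oi (f \+ g) = oi f + oi g.
Proof.
move=> mf mg f0 g0.
have [phi [sphi phif phiv]] := oint_approx mf f0.
have [psi [spsi psig psiv]] := oint_approx mg g0.
apply: (@ointE (fun n => phi n \+ psi n)) => [n|x|].
- exact: nonneg_simpleD.
- apply: nondecreasing_cvg_increases_to => [m n mn|].
    by apply: lerD; [apply (phif x).1|apply (psig x).1].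
  by apply: cvgD; exact: increases_to_cvg.
- by under eq_fun do rewrite simple_ointD//; exact: increases_toD.
Qed.

Lemma ointZ r f : 0 <= r -> measurable_map Omega f -> (forall x, 0 <= f x) ->
  oi (r \*o f) = topped_scale r (oi f).
Proof.
move=> r0 mf f0; have [phi [sphi phif phiv]] := oint_approx mf f0.
apply: (@ointE (fun n => r \*o phi n)) => [n|x|].
- exact: nonneg_simpleZ.
- apply: nondecreasing_cvg_increases_to => [m n mn|].
    by apply: ler_wpM2l => //; apply (phif x).1.
  by apply: cvgM; [exact: cvg_cst|exact: increases_to_cvg].
- by under eq_fun do rewrite simple_ointZ//; exact: increases_to_scale.
Qed.

Lemma oint_indic D : Omega D -> oi (\1_D : X -> R) = mu D.
Proof.
move=> mD; apply: (@ointE (fun=> \1_D)) => [_|x|].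
- exact: nonneg_simple_indic.
- exact: increases_to_cst.
- by rewrite simple_oint_indic//; exact: increases_to_cst.
Qed.

(** * Integrable functions and linearity of the integral *)

Definition nonneg_integrable f :=
  [/\ measurable_map Omega f, forall x, 0 <= f x & oi f <> infty].

Lemma nonneg_integrable_oint f : nonneg_integrable f ->
  fin (fin_part (oi f)) = oi f.
Proof. by case=> _ _; exact: fin_partK. Qed.

Lemma nonneg_integrable_le f g : measurable_map Omega f ->
  (forall x, 0 <= f x) -> nonneg_integrable g -> (forall x, f x <= g x) ->
  nonneg_integrable f.
Proof.
move=> mf f0 [mg g0 g_fin] fg; split=> //.
exact: le_finite (oint_le mf mg f0 fg) g_fin.
Qed.

Lemma nonneg_integrableD f g : nonneg_integrable f -> nonneg_integrable g ->
  nonneg_integrable (f \+ g) /\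
  fin_part (oi (f \+ g)) = fin_part (oi f) + fin_part (oi g).
Proof.
move=> If Ig; have [mf f0 _] := If; have [mg g0 _] := Ig.
have e : oi (f \+ g) = fin (fin_part (oi f) + fin_part (oi g)).
  by rewrite ointD// finD !nonneg_integrable_oint.
split; last by rewrite e.
split; [exact: measurable_mapD|by move=> x; exact: addr_ge0|by rewrite e].
Qed.

Lemma nonneg_integrableZ r f : 0 <= r -> nonneg_integrable f ->
  nonneg_integrable (r \*o f) /\ fin_part (oi (r \*o f)) = r *: fin_part (oi f).
Proof.
move=> r0 If; have [mf f0 _] := If.
have e : oi (r \*o f) = fin (r *: fin_part (oi f)).
  by rewrite ointZ// -[in LHS]nonneg_integrable_oint.
split; last by rewrite e.
split; [exact: measurable_mapZ|by move=> x; exact: mulr_ge0|by rewrite e].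
Qed.

Lemma measurable_map_diff f g : measurable_map Omega f ->
  measurable_map Omega g -> measurable_map Omega (f \- g).
Proof.
move=> mf mg; rewrite (_ : f \- g = f \+ (-1) \*o g).
  by apply: measurable_mapD => //; exact: measurable_mapZ.
by apply/funext => x /=; rewrite mulN1r.
Qed.

Lemma L1P f : L1 Omega mu f ->
  [/\ nonneg_integrable f^\+, nonneg_integrable f^\- & f = f^\+ \- f^\-].
Proof.
case=> mf f_fin; have I : nonneg_integrable (fun x => `|f x|).
  by split=> //; exact: measurable_map_abs.
split; last by rewrite -[LHS]funrposBneg.
- apply: (nonneg_integrable_le _ _ I) => [|x|x].
  + exact: measurable_map_pos.
  + exact: funrpos_ge0.
  + by rewrite /funrpos ge_max ler_norm normr_ge0.
- apply: (nonneg_integrable_le _ _ I) => [|x|x].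
  + exact: measurable_map_neg.
  + exact: funrneg_ge0.
  + by rewrite /funrneg ge_max -normrN ler_norm normr_ge0.
Qed.

(** The integral may be computed from any decomposition into nonnegative integrable functions: with
    h = f - g one has h^+ + g = h^- + f, and additivity on nonnegative functions applies to both
    sides. *)
Lemma L1_diff f g : nonneg_integrable f -> nonneg_integrable g ->
  L1 Omega mu (f \- g) /\
  Iint Omega mu (f \- g) = fin_part (oi f) - fin_part (oi g).
Proof.
move=> If Ig; have [mf f0 _] := If; have [mg g0 _] := Ig.
have [Ifg _] := nonneg_integrableD If Ig.
have mfg : measurable_map Omega (f \- g) by exact: measurable_map_diff.
have Lfg : L1 Omega mu (f \- g).
  suff [_ _] : nonneg_integrable (fun x => `|(f \- g) x|) by split.
  apply: (nonneg_integrable_le _ _ Ifg) => // [|x /=].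
    exact: measurable_map_abs.
  by rewrite (le_trans (ler_normB _ _))// !ger0_norm.
split=> //; have [Ip In _] := L1P Lfg.
have [_ e1] := nonneg_integrableD Ip Ig.
have [_ e2] := nonneg_integrableD In If.
rewrite /Iint; apply/eqP; rewrite subr_eq addrAC -subr_eq opprK -e1 addrC -e2.
apply/eqP; congr (fin_part (oi _)); apply/funext => x /=.
have : (f \- g)^\+ x - (f \- g)^\- x = f x - g x.
  by rewrite -[RHS]/((f \- g) x) -[in RHS](funrposBneg (f \- g)).
lra.
Qed.

Lemma L1_indic D : Omega D -> mu D <> infty ->
  [/\ nonneg_integrable (\1_D : X -> R), L1 Omega mu (\1_D : X -> R) &
      Iint Omega mu (\1_D : X -> R) = fin_part (mu D)].
Proof.
move=> mD fD; have ID : nonneg_integrable (\1_D : X -> R).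
  by split; [exact: measurable_map_indic|by []|rewrite oint_indic].
have m0 := sigma_algebra_empty HOmega.
(* The indicator of [D] is written as its difference with the zero function, so that [L1_diff]
   evaluates [Iint] on it. *)
have I0 : nonneg_integrable (\1_set0 : X -> R).
  by split; [exact: measurable_map_indic|by []|
    rewrite oint_indic// (is_measure0 Hmu)].
have [LD ED] := L1_diff ID I0.
have e : (\1_D : X -> R) \- \1_set0 = \1_D.
  by apply/funext => x /=; rewrite !indicE in_set0 subr0.
rewrite e in LD ED; split=> //.
by rewrite ED !oint_indic// (is_measure0 Hmu) subr0.
Qed.

Lemma L1D f g : L1 Omega mu f -> L1 Omega mu g ->
  L1 Omega mu (f \+ g) /\
  Iint Omega mu (f \+ g) = Iint Omega mu f + Iint Omega mu g.
Proof.
move=> /L1P[fp fn fE] /L1P[gp gn gE].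
have [Ip ep] := nonneg_integrableD fp gp.
have [In en] := nonneg_integrableD fn gn.
have [L e] := L1_diff Ip In.
rewrite (_ : f \+ g = (f^\+ \+ g^\+) \- (f^\- \+ g^\-)); last first.
  by apply/funext => x; rewrite {1}fE {1}gE /= opprD addrACA.
by split=> //; rewrite e ep en /Iint opprD addrACA.
Qed.

Lemma L1Z r f : L1 Omega mu f ->
  L1 Omega mu (r \*o f) /\ Iint Omega mu (r \*o f) = r *: Iint Omega mu f.
Proof.
move=> /L1P[fp fn fE]; have [r0|/ltW r0] := leP 0 r.
  have [Ip ep] := nonneg_integrableZ r0 fp.
  have [In en] := nonneg_integrableZ r0 fn.
  have [L e] := L1_diff Ip In.
  rewrite (_ : r \*o f = (r \*o f^\+) \- (r \*o f^\-)); last first.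
    by apply/funext => x; rewrite {1}fE /= mulrBr.
  by split=> //; rewrite e ep en /Iint scalerBr.
(* For negative r the positive and negative parts change roles, each scaled by - r. *)
rewrite -oppr_ge0 in r0; have [Ip ep] := nonneg_integrableZ r0 fp.
have [In en] := nonneg_integrableZ r0 fn.
have [L e] := L1_diff In Ip.
rewrite (_ : r \*o f = (- r \*o f^\-) \- (- r \*o f^\+)); last first.
  by apply/funext => x; rewrite {1}fE /= !mulNr opprK mulrBr addrC.
by split=> //; rewrite e ep en /Iint !scaleNr opprK scalerBr addrC.
Qed.

Lemma bounded_measurable_L1 : finite_measure mu ->
  bounded_measurable Omega (R := R) `<=` L1 Omega mu.
Proof.
move=> mu_fin f [mf [M fM]]; split=> //.
have mT := sigma_algebra_setT HOmega.
have [IT _ _] := L1_indic mT mu_fin.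
(* The bound M may be negative when [X] is empty, whence the maximum with 0. *)
have M0 : 0 <= Num.max M 0 by rewrite le_max lexx orbT.
have [IM _] := nonneg_integrableZ M0 IT.
suff [] : nonneg_integrable (fun x => `|f x|) by [].
apply: (nonneg_integrable_le _ _ IM) => // [|x /=].
  exact: measurable_map_abs.
by rewrite indicE in_setT mulr1 le_max fM.
Qed.

End order_integral_theory.
Arguments nonneg_integrable {X} Omega {R E} mu f.

(** * Integration with values in an algebra *)

Section partially_ordered_algebra.
Context {R : realType} {A : poAlgType R}.
Implicit Types a b c e : A.

Lemma poalg_mul0r a : (0%R * a)%g = 0.
Proof. by rewrite -[in LHS](scale0r (0 : A)) poalg_scaleAl scale0r. Qed.

Lemma poalg_mulr0 a : (a * 0%R)%g = 0.
Proof. by rewrite -[in LHS](scale0r (0 : A)) poalg_scaleAr scale0r. Qed.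

Lemma poalg_mulNl a b : ((- a)%R * b)%g = - (a * b)%g.
Proof. by rewrite -scaleN1r poalg_scaleAl scaleN1r. Qed.

Lemma poalg_mulNr a b : (a * (- b)%R)%g = - (a * b)%g.
Proof. by rewrite -scaleN1r poalg_scaleAr scaleN1r. Qed.

Lemma poalg_mul_suml (I : Type) (s : seq I) (F : I -> A) b :
  ((\sum_(i <- s) F i)%R * b)%g = \sum_(i <- s) (F i * b)%g.
Proof.
exact: (big_morph (fun a => (a * b)%g) (fun a c => poalg_mulDl a c b)
  (poalg_mul0r b)).
Qed.

Lemma poalg_mul_sumr (I : Type) (s : seq I) (F : I -> A) a :
  (a * (\sum_(i <- s) F i)%R)%g = \sum_(i <- s) (a * F i)%g.
Proof.
exact: (big_morph (fun b => (a * b)%g) (poalg_mulDr a) (poalg_mulr0 a)).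
Qed.

Lemma poalg_mulBB a b c e : ((a - b)%R * (c - e)%R)%g =
  ((a * c)%g + (b * e)%g) - ((a * e)%g + (b * c)%g).
Proof.
rewrite poalg_mulDl !poalg_mulDr !poalg_mulNl !poalg_mulNr opprK opprD.
by rewrite [X in _ + X = _]addrC addrACA.
Qed.

Lemma poalg_mul_le a b c e :
  0 <= a -> a <= b -> 0 <= c -> c <= e -> (a * c)%g <= (b * e)%g.
Proof.
move=> a0 ab c0 ce; have b0 : 0 <= b by exact: le_trans ab.
apply: (@le_trans _ _ (b * c)%g).
  rewrite -pov_subr_ge0 -poalg_mulNl -poalg_mulDl.
  by apply: poalg_mul_ge0; rewrite ?pov_subr_ge0.
rewrite -pov_subr_ge0 -poalg_mulNr -poalg_mulDr.
by apply: poalg_mul_ge0; rewrite ?pov_subr_ge0.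
Qed.

(** Continuity acts on one factor at a time: first u grows against the fixed b, then v against a
    fixed [u m]. Monotonicity bounds [u m * v n] by the diagonal term at the larger index. *)
Lemma increases_to_mulg (u v : nat -> A) a b :
  sigma_monotone_continuous_mul A ->
  (forall n, 0 <= u n) -> (forall n, 0 <= v n) ->
  increases_to u a -> increases_to v b ->
  increases_to (fun n => (u n * v n)%g) (a * b)%g.
Proof.
move=> cA u0 v0 ua vb.
have a0 : 0 <= a by exact: le_trans (u0 0%N) (increases_to_le 0%N ua).
have b0 : 0 <= b by exact: le_trans (v0 0%N) (increases_to_le 0%N vb).
apply: increases_to_intro => [m n mn|n|c uvc].
- by apply: poalg_mul_le => //; [apply ua.1|apply vb.1].
- by apply: poalg_mul_le => //; exact: increases_to_le.
have [_ uba] := cA u a u0 a0 ua b b0.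
apply: (increases_to_least uba) => m.
have [umb _] := cA v b v0 b0 vb (u m) (u0 m).
apply: (increases_to_least umb) => n; apply: le_trans (uvc (maxn m n)).
apply: poalg_mul_le => //.
  by apply: ua.1; rewrite leq_maxl.
by apply: vb.1; rewrite leq_maxr.
Qed.

(** * Multiplicativity of the integral for spectral measures *)

Context {X : Type} {Omega : set (set X)} {mu : set X -> topped A}.
Context (HOmega : sigma_algebra [set: X] Omega) (Hmu : is_measure Omega mu).
Implicit Types (D : set X) (f g phi psi : X -> R).

(** Multiplying the level set expansions writes the product as a combination of indicators of joint
    level sets, whose measures factor by spectrality. *)
Lemma simple_oint_mul phi psi : is_spectral Omega mu ->
  nonneg_simple Omega phi -> nonneg_simple Omega psi ->
  simple_oint mu phi <> infty -> simple_oint mu psi <> infty ->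
  simple_oint mu (phi \* psi) =
    fin (fin_part (simple_oint mu phi) * fin_part (simple_oint mu psi))%g.
Proof.
move=> specmu sphi spsi; have [_ fphi phi0] := sphi; have [_ fpsi psi0] := spsi.
have mphi r : Omega (phi @^-1` [set r]) by exact: nonneg_simple_level.
have mpsi r : Omega (psi @^-1` [set r]) by exact: nonneg_simple_level.
pose s := elems (range phi); pose t := elems (range psi).
pose st := [seq (p, q) | p <- s, q <- t].
pose Q (p : R * R) := (phi @^-1` [set p.1]) `&` (psi @^-1` [set p.2]).
have mQ p : Omega (Q p) by exact: sigma_algebra_setI.
have st0 p : p \in st -> 0 <= p.1 * p.2.
  case/allpairsP => -[a b] /= [+ + ->]; rewrite !in_fset_set// !inE.
  by move=> [x _ <-] [y _ <-] /=; exact: mulr_ge0.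
have -> : phi \* psi = fun x => \sum_(p <- st) (p.1 * p.2) * \1_(Q p) x.
  apply/funext => x /=; rewrite big_allpairs.
  rewrite (simple_function_sum x sphi) (simple_function_sum x spsi) big_distrlr.
  by apply: eq_bigr => a _; apply: eq_bigr => b _; rewrite indicI mulrACA.
have [_ ->] := simple_oint_sum_indic HOmega Hmu st0 mQ.
rewrite (simple_oint_comp HOmega Hmu id fphi mphi).
rewrite (simple_oint_comp HOmega Hmu id fpsi mpsi) -/s -/t => fins fint.
have {}fins := topped_sum_finite fins; have {}fint := topped_sum_finite fint.
have sumE (I : eqType) (l : seq I) (F : I -> topped A) :
    {in l, forall i, F i <> infty} ->
    \sum_(i <- l) F i = fin (\sum_(i <- l) fin_part (F i)).
  elim: l => [_|i l ih Fl]; first by rewrite !big_nil.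
  rewrite !big_cons ih ?finD ?fin_partK//; first by apply: Fl; rewrite mem_head.
  by move=> j jl; apply: Fl; rewrite inE jl orbT.
(* Spectrality concerns sets of finite measure. A level set at a nonzero value is such a set because
   the integral is finite; the zero level sets may have infinite measure, but their terms vanish on
   both sides by the convention 0 * infty = 0. *)
have QE (a b : R) : a \in s -> b \in t -> topped_scale (a * b) (mu (Q (a, b))) =
    fin (fin_part (topped_scale a (mu (phi @^-1` [set a]))) *
         fin_part (topped_scale b (mu (psi @^-1` [set b]))))%g.
  move=> /fins + /fint; have [->|a0] := eqVneq a 0.
    by rewrite mul0r !topped_scale0 poalg_mul0r.
  have [->|b0] := eqVneq b 0.
    by rewrite mulr0 !topped_scale0 poalg_mulr0.
  case Ea: (mu _) => [ma|]; last by rewrite topped_scale_infty.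
  case Eb: (mu (psi @^-1` _)) => [mb|]; last by rewrite (topped_scale_infty b0).
  move=> _ _; rewrite (specmu _ _ ma mb)//=.
  by rewrite poalg_scaleAl poalg_scaleAr scalerA.
rewrite !sumE//=; last first.
  by case=> a b /allpairsP[[a' b']] /= [a's b't [-> ->]]; rewrite QE.
rewrite poalg_mul_suml big_allpairs /=; congr fin; apply: eq_big_seq => a as_.
by rewrite poalg_mul_sumr; apply: eq_big_seq => b bt; rewrite QE.
Qed.

Local Notation oi f := (oint Omega mu (EFin \o f)).

Context (HA : sigma_monotone_complete A).
Context (Hmul : sigma_monotone_continuous_mul A).

(** Products of the approximants increase to the product. Their integrals lie below finite ones, so
    [simple_oint_mul] applies, and [increases_to_mulg] gives the supremum in [A]. *)
Lemma nonneg_integrableM f g : is_spectral Omega mu ->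
  nonneg_integrable Omega mu f -> nonneg_integrable Omega mu g ->
  nonneg_integrable Omega mu (f \* g) /\
  fin_part (oi (f \* g)) = (fin_part (oi f) * fin_part (oi g))%g.
Proof.
move=> specmu If Ig; have [mf f0 f_fin] := If; have [mg g0 g_fin] := Ig.
suff e : oi (f \* g) = fin (fin_part (oi f) * fin_part (oi g))%g.
  split; last by rewrite e.
  split; [exact: measurable_mapM|by move=> x; exact: mulr_ge0|by rewrite e].
have [phi [sphi phif phiv]] := oint_approx HOmega Hmu HA mf f0.
have [psi [spsi psig psiv]] := oint_approx HOmega Hmu HA mg g0.
have phi_fin n := le_finite (increases_to_le n phiv) f_fin.
have psi_fin n := le_finite (increases_to_le n psiv) g_fin.
apply: (@ointE _ _ _ _ _ HOmega Hmu (fun n => phi n \* psi n)) => [n|x|].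
- exact: nonneg_simpleM.
- have phi0 n : 0 <= phi n x by case: (sphi n).
  have psi0 n : 0 <= psi n x by case: (spsi n).
  apply: nondecreasing_cvg_increases_to => [m n mn|].
    by apply: ler_pM => //; [apply (phif x).1|apply (psig x).1].
  by apply: cvgM; exact: increases_to_cvg.
under eq_fun do rewrite simple_oint_mul//.
apply/increases_to_fin; apply: increases_to_mulg => // [n|n||].
- by rewrite -le_fin fin_partK//; exact: simple_oint_ge0 HOmega Hmu _ (sphi n).
- by rewrite -le_fin fin_partK//; exact: simple_oint_ge0 HOmega Hmu _ (spsi n).
- apply/increases_to_fin; rewrite fin_partK//.
  by under eq_fun do rewrite (fin_partK (phi_fin _)).
- apply/increases_to_fin; rewrite fin_partK//.
  by under eq_fun do rewrite (fin_partK (psi_fin _)).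
Qed.

(** Expanding (f^+ - f^-) (g^+ - g^-) and collecting terms by sign gives a difference of nonnegative
    integrable functions, to which [L1_diff] applies. *)
Lemma L1M f g : is_spectral Omega mu -> L1 Omega mu f -> L1 Omega mu g ->
  L1 Omega mu (f \* g) /\
  Iint Omega mu (f \* g) = (Iint Omega mu f * Iint Omega mu g)%g.
Proof.
move=> specmu Lf Lg.
have [fp fn fE] := L1P HOmega Hmu HA Lf.
have [gp gn gE] := L1P HOmega Hmu HA Lg.
have [Ipp epp] := nonneg_integrableM specmu fp gp.
have [Inn enn] := nonneg_integrableM specmu fn gn.
have [Ipn epn] := nonneg_integrableM specmu fp gn.
have [Inp enp] := nonneg_integrableM specmu fn gp.
have [Ip ep] := nonneg_integrableD HOmega Hmu HA Ipp Inn.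
have [In en] := nonneg_integrableD HOmega Hmu HA Ipn Inp.
have [L e] := L1_diff HOmega Hmu HA Ip In.
rewrite (_ : f \* g = ((f^\+ \* g^\+) \+ (f^\- \* g^\-)) \-
    ((f^\+ \* g^\-) \+ (f^\- \* g^\+))); last first.
  apply/funext => x; rewrite {1}fE {1}gE /=; ring.
by split=> //; rewrite e ep en epp enn epn enp /Iint poalg_mulBB.
Qed.

Lemma L1_algebra_hom : is_spectral Omega mu ->
  is_algebra_hom_on (L1 Omega mu) (Iint Omega mu).
Proof.
move=> specmu; split=> [f g Lf Lg|r f Lf|f g Lf Lg].
- by have [] := L1D HOmega Hmu HA Lf Lg.
- by have [] := L1Z HOmega Hmu HA r Lf.
- by have [] := L1M specmu Lf Lg.
Qed.

Lemma L1_comm_fun_algebra : is_spectral Omega mu ->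
  is_comm_fun_algebra (L1 Omega mu).
Proof.
move=> specmu; have m0 := sigma_algebra_empty HOmega.
have [|_ L0 _] := L1_indic HOmega Hmu HA m0; first by rewrite (is_measure0 Hmu).
split=> [|f g Lf Lg|r f Lf|f g Lf Lg|f g _ _].
- rewrite (_ : \0 = (\1_set0 : X -> R))//.
  by apply/funext => x; rewrite indicE in_set0.
- by have [] := L1D HOmega Hmu HA Lf Lg.
- by have [] := L1Z HOmega Hmu HA r Lf.
- by have [] := L1M specmu Lf Lg.
- by apply/funext => x /=; rewrite mulrC.
Qed.

(** Asking for multiplicativity on indicators alone makes this usable both for integrable and for
    bounded functions. *)
Lemma spectral_of_indic_mul :
  (forall D1 D2, Omega D1 -> Omega D2 -> mu D1 <> infty -> mu D2 <> infty ->
    let f : X -> R := \1_D1 in let g : X -> R := \1_D2 in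
    L1 Omega mu (f \* g) /\
    Iint Omega mu (f \* g) = (Iint Omega mu f * Iint Omega mu g)%g) ->
  is_spectral Omega mu.
Proof.
move=> mulI D1 D2 a1 a2 m1 m2 e1 e2.
have fin1 : mu D1 <> infty by rewrite e1.
have fin2 : mu D2 <> infty by rewrite e2.
have m12 := sigma_algebra_setI HOmega m1 m2.
have [] := mulI D1 D2 m1 m2 fin1 fin2.
have -> : \1_D1 \* \1_D2 = (\1_(D1 `&` D2) : X -> R) by rewrite indicI.
(* An indicator equals its absolute value, so membership in [L1] says that the intersection has
   finite measure. *)
case=> _ + e; have -> : (fun x => `|\1_(D1 `&` D2) x : R|%:E) =
    EFin \o (\1_(D1 `&` D2) : X -> R).
  by apply/funext => x /=; rewrite ger0_norm.
rewrite oint_indic// => fin12.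
have [_ _ I1] := L1_indic HOmega Hmu HA m1 fin1.
have [_ _ I2] := L1_indic HOmega Hmu HA m2 fin2.
have [_ _ I12] := L1_indic HOmega Hmu HA m12 fin12.
by rewrite -(fin_partK fin12) -I12 e I1 I2 e1 e2.
Qed.

Lemma indic_bounded_measurable D :
  Omega D -> bounded_measurable Omega (\1_D : X -> R).
Proof.
move=> mD; split; first exact: measurable_map_indic.
by exists 1 => x; rewrite ger0_norm// indicE; case: (_ \in _).
Qed.

Lemma spectral_idempotent_comm : finite_measure mu -> is_spectral Omega mu <->
  (forall D : set X, Omega D ->
     (fin_part (mu D) * fin_part (mu D))%g = fin_part (mu D)) /\
  (forall D1 D2 : set X, Omega D1 -> Omega D2 ->
     (fin_part (mu D1) * fin_part (mu D2))%g =
     (fin_part (mu D2) * fin_part (mu D1))%g).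
Proof.
(* By monotonicity every measurable set has finite measure, so [fin_part] loses no information. *)
move=> mu_fin; have fin_mu D : Omega D -> mu D = fin (fin_part (mu D)).
  move=> mD; rewrite fin_partK//; apply: le_finite mu_fin.
  by apply: (measure_le HOmega Hmu mD); [exact: sigma_algebra_setT|].
split=> [specmu|[idem comm]].
  have muI D1 D2 : Omega D1 -> Omega D2 ->
      fin_part (mu (D1 `&` D2)) = (fin_part (mu D1) * fin_part (mu D2))%g.
    by move=> m1 m2; rewrite (specmu _ _ _ _ m1 m2 (fin_mu _ m1) (fin_mu _ m2)).
  split=> [D mD|D1 D2 m1 m2]; first by rewrite -muI// setIid.
  by rewrite -!muI// setIC.
pose m D := fin_part (mu D).
have mU D1 D2 : Omega D1 -> Omega D2 -> D1 `&` D2 = set0 ->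
    m (D1 `|` D2) = m D1 + m D2.
  move=> m1 m2 d12; apply: fin_inj; rewrite finD -!fin_mu//.
    exact: (measure_setU HOmega Hmu).
  exact: sigma_algebra_setU.
have m_idem D : Omega D -> (m D * m D)%g = m D by exact: idem.
have m_disj D1 D2 : Omega D1 -> Omega D2 -> D1 `&` D2 = set0 ->
    (m D1 * m D2)%g = 0.
  move=> m1 m2 d12; have := m_idem _ (sigma_algebra_setU HOmega m1 m2).
  rewrite mU// poalg_mulDl !poalg_mulDr !m_idem//.
  rewrite (comm D2 D1 m2 m1 : (m D2 * m D1)%g = (m D1 * m D2)%g).
  (* Cancelling [m D1 + m D2] from the expanded square leaves twice the product equal to 0, and 2 is
     invertible in [R]. *)
  rewrite [X in _ + X = _]addrC addrACA -[RHS]addr0 => /addrI h.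
  have : (2 : R) *: (m D1 * m D2)%g = 0 by rewrite scaler_nat mulr2n.
  by move/eqP; rewrite scaler_eq0 pnatr_eq0 /= => /eqP.
have m_split D D' : Omega D -> Omega D' -> m D = m (D `\` D') + m (D `&` D').
  move=> mD mD'; rewrite -mU; last 1 first.
  - by apply/seteqP; split=> // x [[_ +] [_]].
  - by rewrite setUC setUIDK.
  - exact: sigma_algebra_setD.
  - exact: sigma_algebra_setI.
move=> D1 D2 a1 a2 m1 m2 e1 e2.
have mI := sigma_algebra_setI HOmega m1 m2.
have m12 := sigma_algebra_setD HOmega m1 m2.
have m21 := sigma_algebra_setD HOmega m2 m1.
have -> : a1 = m (D1 `\` D2) + m (D1 `&` D2) by rewrite -m_split// /m e1.
have -> : a2 = m (D2 `\` D1) + m (D1 `&` D2).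
  by rewrite setIC -m_split// /m e2.
have d1 : (m (D1 `\` D2) * m (D2 `\` D1))%g = 0.
  by apply: m_disj => //; apply/seteqP; split=> // x [[_ +] [+ _]].
have d2 : (m (D1 `\` D2) * m (D1 `&` D2))%g = 0.
  by apply: m_disj => //; apply/seteqP; split=> // x [[_ +] [_]].
have d3 : (m (D1 `&` D2) * m (D2 `\` D1))%g = 0.
  by apply: m_disj => //; apply/seteqP; split=> // x [[+ _] [_]].
(* Three of the four products come from disjoint sets; the square of the measure of the intersection
   remains. *)
rewrite poalg_mulDl !poalg_mulDr d1 d2 d3 (m_idem _ mI) !add0r.
exact: fin_mu.
Qed.

End partially_ordered_algebra.

Theorem proposition4p2 (R : realType) (X : Type) (Omega : set (set X))
    (A : poAlgType R) (mu : set X -> topped A)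
    (HOmega : sigma_algebra [set: X] Omega)
    (HA : sigma_monotone_complete A)
    (Hmul : sigma_monotone_continuous_mul A)
    (Hmu : is_measure Omega mu) :
  let P1 := is_comm_fun_algebra (L1 Omega mu) /\
            is_algebra_hom_on (L1 Omega mu) (Iint Omega mu) in
  let P2 := is_spectral Omega mu in
  let P3 := is_algebra_hom_on (bounded_measurable Omega (R := R))
              (Iint Omega mu) in
  let P4 :=
    (forall D : set X, Omega D ->
       (fin_part (mu D) * fin_part (mu D))%g = fin_part (mu D)) /\
    (forall D1 D2 : set X, Omega D1 -> Omega D2 ->
       (fin_part (mu D1) * fin_part (mu D2))%g =
       (fin_part (mu D2) * fin_part (mu D1))%g) in
  (P1 <-> P2) /\
  (finite_measure mu -> (P2 <-> P3) /\ (P3 <-> P4)).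
Proof.
move=> P1 P2 P3 P4; split=> [|mu_fin].
  split=> [[[_ _ _ mulL1 _] [_ _ mulI]]|specmu]; last first.
    by split; [exact: L1_comm_fun_algebra|exact: L1_algebra_hom].
  apply: spectral_of_indic_mul => // D1 D2 m1 m2 fin1 fin2 f g.
  have [_ Lf _] := L1_indic HOmega Hmu HA m1 fin1.
  have [_ Lg _] := L1_indic HOmega Hmu HA m2 fin2.
  by split; [exact: mulL1|exact: mulI].
(* Bounded functions are integrable here, so the homomorphism property on [L1] restricts to them;
   indicators are bounded, which gives the converse. *)
have subL1 := bounded_measurable_L1 HOmega Hmu HA mu_fin.
have P23 : P2 <-> P3.
  split=> [specmu|[_ _ mulI]].
    have [IntD IntZ IntM] := L1_algebra_hom HOmega Hmu HA Hmul specmu.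
    split=> [f g /subL1 Lf /subL1 Lg|r f /subL1 Lf|f g /subL1 Lf /subL1 Lg].
    - exact: IntD.
    - exact: IntZ.
    - exact: IntM.
  apply: spectral_of_indic_mul => // D1 D2 m1 m2 _ _ f g.
  have bf : bounded_measurable Omega f by exact: indic_bounded_measurable.
  have bg : bounded_measurable Omega g by exact: indic_bounded_measurable.
  split; last exact: mulI.
  rewrite /f /g -indicI; apply/subL1/indic_bounded_measurable => //.
  exact: sigma_algebra_setI.
split=> //; rewrite -P23; exact: spectral_idempotent_comm.
Qed.
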